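(* Let $A$ be a finite alphabet with $m=|A|$ elements, let $n\ge 1$ be a fixed integer, and let $X_1^n=(X_1,\ldots,X_n)$ be exchangeable random variables with values in $A$. Let $\mathcal{P}$ be the simplex of probability distributions on $A$, let $\hat{P}_{X_1^n}$ be the (random) type of $X_1^n$, and let $\mu=\mu_n$ be the law of $\hat{P}_{X_1^n}$ on $\mathcal{P}$. For $1\le k\le n$, let $P_k$ denote the distribution of $X_1^k=(X_1,\ldots,X_k)$ on $A^k$ and let $M_{\mu,k}$ denote the mixture of i.i.d. distributions $$M_{\mu,k}(x_1^k)=\int_{\mathcal{P}} Q^k(x_1^k)\,d\mu(Q),\qquad x_1^k\in A^k.$$ Then, for any integer $k$ with $1\le k\le (n/100)^{1/3}$, $$D(P_k\|M_{\mu,k})\le 2\delta+k\,e^{-\frac{n}{k}\delta}\Bigl(\frac{n}{k}+1\Bigr)^{2m^k}\log n,$$ where $$\alpha=\alpha_{n,k}=\Bigl[\frac{2k}{\sqrt{n}}\Bigl(\frac{1+2k}{\sqrt{n}}+1\Bigr)\Bigr]^{1/2}\qquad\text{and}\qquad \delta=\delta_{n,k}=\alpha\log\Bigl(\frac{m^k}{\alpha}\Bigr).$$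
   Context: All logarithms are natural. Random variables $X_1,\ldots,X_n$ are exchangeable if for every permutation $\pi$ of $\{1,\ldots,n\}$ the distribution of $(X_{\pi(1)},\ldots,X_{\pi(n)})$ is the same as that of $(X_1,\ldots,X_n)$. The type of a string $x_1^n=(x_1,\ldots,x_n)\in A^n$ is the empirical probability mass function it induces on $A$: $\hat{P}_{x_1^n}(a)=\frac1n|\{i: x_i=a\}|$, $a\in A$. For a probability distribution $Q$ on $A$, $Q^k$ denotes the $k$-fold product distribution on $A^k$, i.e. $Q^k(x_1^k)=\prod_{i=1}^k Q(x_i)$. For probability mass functions $P,Q$ on the same finite set $B$, the relative entropy is $D(P\|Q)=\sum_{x\in B}P(x)\log\frac{P(x)}{Q(x)}$ (with $0\log(0/q)=0$), which equals $+\infty$ if $P$ is not absolutely continuous with respect to $Q$. *)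

(* Defs.v *)
From HB Require Import structures.
From mathcomp Require Import all_boot all_order all_algebra perm.
From mathcomp Require Import all_classical all_reals all_analysis.

Set Implicit Arguments.
Unset Strict Implicit.
Unset Printing Implicit Defensive.

Import Order.TTheory GRing.Theory Num.Theory.
Import numFieldNormedType.Exports.

Local Open Scope classical_set_scope.
Local Open Scope ring_scope.

(* The library's random variables take values in a [measurableType], hence in a
   pointed type. The alphabet is only a [finType] here, and it carries its
   discrete sigma-algebra. *)
Record finite_rv d (Omega : measurableType d) (A : finType) := FiniteRV {
  rv_fun :> Omega -> A;
  rv_measurable : forall S : set A, d.-measurable (rv_fun @^-1` S) }.

Definition joint d (Omega : measurableType d) (A : finType) n
    (X : 'I_n -> finite_rv Omega A) (w : Omega) : n.-tuple A :=
  [tuple X i w | i < n].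

Lemma joint_measurable d (Omega : measurableType d) (A : finType) n
    (X : 'I_n -> finite_rv Omega A) (S : set (n.-tuple A)) :
  d.-measurable (joint X @^-1` S).
Proof.
have -> : joint X @^-1` S =
    \bigcup_(x in S) \bigcap_(i in [set: 'I_n]) (X i @^-1` [set tnth x i]).
  apply/seteqP; split => w /=.
    by move=> Sw; exists (joint X w) => // i _ /=; rewrite tnth_mktuple.
  move=> [x Sx xw]; suff -> : joint X w = x by [].
  by apply: eq_from_tnth => i; rewrite tnth_mktuple; exact: xw.
apply: fin_bigcup_measurable; first exact: finite_finset.
move=> x _; apply: fin_bigcap_measurable; first exact: finite_finset.
by move=> i _; exact: rv_measurable.
Qed.

Definition exchangeable d (Omega : measurableType d) (R : realType)
    (P : probability Omega R) (A : finType) n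
    (X : 'I_n -> finite_rv Omega A) : Prop :=
  forall (s : {perm 'I_n}) (S : set (n.-tuple A)),
    P (joint (fun i => X (s i)) @^-1` S) = P (joint X @^-1` S).

(* [fine] is harmless: probabilities are finite. *)
Definition joint_pmf d (Omega : measurableType d) (R : realType)
    (P : probability Omega R) (A : finType) n
    (X : 'I_n -> finite_rv Omega A) (x : n.-tuple A) : R :=
  fine (P (joint X @^-1` [set x])).

Definition first_rvs d (Omega : measurableType d) (A : finType) n k
    (le_k_n : (k <= n)%N) (X : 'I_n -> finite_rv Omega A) :
  'I_k -> finite_rv Omega A := fun i => X (widen_ord le_k_n i).

(* The simplex is a subset of the space of all functions [A -> R], because a
   simplex type would have to be pointed, hence [A] inhabited, in order to be
   a [measurableType]. The ambient sigma-algebra is the product Borel one. *)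
Definition cylinders (R : realType) (A : finType) : set (set (A -> R)) :=
  [set C | exists a : A, exists2 B : set R,
     measurable B & C = (fun Q : A -> R => Q a) @^-1` B].

Definition pmf_space (R : realType) (A : finType) :=
  g_sigma_algebraType (@cylinders R A).

Definition simplex (R : realType) (A : finType) : set (pmf_space R A) :=
  [set Q | (forall a : A, 0 <= Q a) /\ \sum_(a : A) Q a = 1].

Definition type_of (R : realType) (A : finType) n (x : n.-tuple A) :
  pmf_space R A := fun a => #|[pred i : 'I_n | tnth x i == a]|%:R / n%:R.

Definition random_type d (Omega : measurableType d) (R : realType)
    (A : finType) n (X : 'I_n -> finite_rv Omega A) (w : Omega) :
  pmf_space R A := type_of R (joint X w).

Lemma random_type_measurable d (Omega : measurableType d) (R : realType)
    (A : finType) n (X : 'I_n -> finite_rv Omega A) :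
  measurable_fun [set: Omega] (random_type R X).
Proof.
apply: (@measurability _ _ _ (pmf_space R A) _ (random_type R X)
          (@cylinders R A)) => // _ [_ [a [B mB ->]] <-].
rewrite setTI; exact: (joint_measurable X [set x | B (type_of R x a)]).
Qed.

HB.instance Definition _ d (Omega : measurableType d) (R : realType)
    (A : finType) n (X : 'I_n -> finite_rv Omega A) :=
  isMeasurableFun.Build _ _ _ _ (random_type R X)
    (@random_type_measurable _ Omega R A n X).

Definition type_law d (Omega : measurableType d) (R : realType)
    (P : probability Omega R) (A : finType) n
    (X : 'I_n -> finite_rv Omega A) : probability (pmf_space R A) R :=
  distribution P (random_type R X).

Lemma type_of_simplex (R : realType) (A : finType) n (x : n.-tuple A) :
  (0 < n)%N -> simplex (type_of R x).
Proof.
move=> n_gt0; split=> [a|]; first by rewrite divr_ge0 ?ler0n.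
rewrite -mulr_suml -natr_sum; under eq_bigr do rewrite -sum1_card.
rewrite (exchange_big_dep xpredT)//=.
have sum1 (i : 'I_n) : (\sum_(a | i \in [pred i | tnth x i == a]) 1 = 1)%N.
  by rewrite (big_pred1 (tnth x i))// => a; rewrite inE eq_sym.
under eq_bigr do rewrite sum1.
by rewrite sum1_card card_ord divff// pnatr_eq0 -lt0n.
Qed.

Lemma type_law_simplex d (Omega : measurableType d) (R : realType)
    (P : probability Omega R) (A : finType) n
    (X : 'I_n -> finite_rv Omega A) :
  (0 < n)%N -> type_law P X (@simplex R A) = 1%E.
Proof.
move=> n_gt0; rewrite /type_law /distribution /pushforward.
rewrite -(probability_setT P); congr (P _); apply/seteqP; split=> // w _.
exact: type_of_simplex.
Qed.

Definition iid_pmf (R : realType) (A : finType) (Q : A -> R) k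
    (x : k.-tuple A) : R := \prod_(i < k) Q (tnth x i).

Definition mixture (R : realType) (A : finType)
    (mu : probability (pmf_space R A) R) k (x : k.-tuple A) : R :=
  \int[mu]_(Q in @simplex R A) iid_pmf Q x.

(* Terms with [P x = 0] vanish, as required by [0 log (0 / q) = 0]. In
   particular the junk value [P x / 0 = 0] occurs only when [P x = 0]. *)
Definition relative_entropy (R : realType) (B : finType) (P Q : B -> R) :
  \bar R :=
  if [forall x, (Q x == 0) ==> (P x == 0)]
  then (\sum_(x : B) P x * ln (P x / Q x))%:E else +oo%E.

Definition alpha (R : realType) (n k : nat) : R :=
  Num.sqrt (2 * k%:R / Num.sqrt n%:R
            * ((1 + 2 * k%:R) / Num.sqrt n%:R + 1)).

Definition delta (R : realType) (m n k : nat) : R :=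
  alpha R n k * ln ((m ^ k)%:R / alpha R n k).

(* Main.v *)
(* For an injection f of {1..k} into {1..n}, exchangeability makes the tuple
   (X_{f 1}, ..., X_{f k}) distributed as P_k. On the other hand, expanding
   the k-fold product of the type of X shows that n^k M_{mu,k}(x) is the sum of
   P(X_{f 1} = x_1, ..., X_{f k} = x_k) over all maps f. Keeping only the
   injective f gives P_k <= c M_{mu,k} pointwise, with
   c = n^k / (n (n-1) ... (n-k+1)), hence D(P_k || M_{mu,k}) <= ln c <= 2 k^2 / n.
   With t = k / sqrt n <= 1/10 one has 2 t <= alpha^2 and alpha <= 6/10, so
   delta >= alpha (1 - alpha) >= t^2 = k^2 / n: the term 2 delta alone is an
   upper bound. *)
Require Import Defs.
From mathcomp Require Import all_boot all_order all_algebra.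
From mathcomp Require Import perm action primitive_action alt.
From mathcomp Require Import all_classical all_reals all_analysis measurable_realfun.
From mathcomp Require Import zify ring lra.

Import Order.TTheory GRing.Theory Num.Theory.
Import numFieldNormedType.Exports.

Local Open Scope ring_scope.

(** * Exchangeability along injective index maps *)

Lemma inj_extends_perm {n k : nat} (le_k_n : (k <= n)%N) (f : 'I_k -> 'I_n) :
  injective f -> exists s : {perm 'I_n}, forall i, s (widen_ord le_k_n i) = f i.
Proof.
move=> f_inj.
(* The symmetric group on n points is n-transitive, hence k-transitive: some permutation carries the
   distinct tuple of the first k indices to the distinct tuple of the values of [f]. *)
have tr : [transitive^k 'Sym_('I_n), on [set: 'I_n] | 'P]%g.
  by apply: ntransitive_weak (Sym_trans _); rewrite card_ord.
have dt (g : 'I_k -> 'I_n) :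
    injective g -> [tuple g i | i < k] \in k.-dtuple([set: 'I_n]%SET).
  move=> g_inj; apply/dtuple_onP; split=> [i j|i]; last by rewrite inE.
  by rewrite !tnth_mktuple => /g_inj.
have w_inj : injective (widen_ord le_k_n) by move=> i j [/val_inj].
have [s _ sf] := atransP2 tr (dt _ w_inj) (dt _ f_inj).
exists s => i; move/(congr1 (fun t => tnth t i)): sf.
rewrite tnth_mktuple => ->.
by rewrite tnth_map tnth_mktuple.
Qed.


Lemma exchangeable_inj (R : realType) d (Omega : measurableType d)
    (P : probability Omega R) (A : finType) n (X : 'I_n -> finite_rv Omega A) k
    (le_k_n : (k <= n)%N) (f : 'I_k -> 'I_n) (S : set (k.-tuple A)) :
  exchangeable P X -> injective f ->
  P (joint (X \o f) @^-1` S)%classic =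
  P (joint (first_rvs le_k_n X) @^-1` S)%classic.
Proof.
move=> exX /(inj_extends_perm le_k_n)[s sf].
(* Truncation to the first k coordinates turns an event about k variables into one about all n, to
   which exchangeability applies. *)
pose h (y : n.-tuple A) := [tuple tnth y (widen_ord le_k_n i) | i < k].
have -> : (joint (X \o f) @^-1` S =
    joint (fun i => X (s i)) @^-1` (h @^-1` S))%classic.
  congr (_ @^-1` S)%classic; apply/funext => w; apply: eq_from_tnth => i.
  by rewrite /= !tnth_mktuple /= sf.
rewrite exX; congr (P (_ @^-1` S)%classic); apply/funext => w.
apply: eq_from_tnth => i.
by rewrite /= !tnth_mktuple.
Qed.

(** * Joint mass functions *)

Lemma joint_pmf_ge0 (R : realType) d (Omega : measurableType d)
    (P : probability Omega R) (A : finType) n (X : 'I_n -> finite_rv Omega A) x :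
  0 <= joint_pmf P X x.
Proof. exact: fine_ge0. Qed.

Lemma joint_pmfE (R : realType) d (Omega : measurableType d)
    (P : probability Omega R) (A : finType) n (X : 'I_n -> finite_rv Omega A) x :
  (joint_pmf P X x)%:E = P (joint X @^-1` [set x])%classic.
Proof.
by rewrite fineK// fin_num_measure//; exact: joint_measurable.
Qed.

Lemma sum_joint_pmf (R : realType) d (Omega : measurableType d)
    (P : probability Omega R) (A : finType) n (X : 'I_n -> finite_rv Omega A) :
  \sum_x joint_pmf P X x = 1.
Proof.
apply: EFin_inj; rewrite -sumEFin -(probability_setT P).
under eq_bigr do rewrite joint_pmfE.
have <- : (\bigcup_(x in [set: n.-tuple A]) (joint X @^-1` [set x]) = setT)%classic.
  by apply/seteqP; split=> // w _; exists (joint X w).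
rewrite measure_fin_bigcup.
- rewrite [LHS]bigfs ?index_enum_uniq//; last first.
    by move=> x _ /negP[]; exact: mem_index_enum.
  by apply: eq_fsbigl; apply/seteqP; split.
- exact: finite_finset.
- by move=> x y _ _ [w [/= <- <-]].
- by move=> x _; exact: joint_measurable.
Qed.

(** * The mixture as an average over index maps *)

Lemma measurable_eval (R : realType) (A : finType) (a : A) :
  measurable_fun setT (fun Q : pmf_space R A => Q a).
Proof.
by move=> _ B mB; rewrite setTI; apply: sub_gen_smallest; exists a, B.
Qed.

Lemma measurable_simplex (R : realType) (A : finType) :
  measurable (@simplex R A).
Proof.
have -> : @simplex R A = (
    (\bigcap_(a in [set: A]) ((fun Q : pmf_space R A => Q a) @^-1` `[0, +oo[)) `&`
    ((fun Q : pmf_space R A => \sum_a Q a) @^-1` [set 1%R]))%classic.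
  apply/seteqP; split=> Q [/= Q0 Q1]; split=> // a.
    by move=> _ /=; rewrite in_itv/= andbT.
  by have /= := Q0 a Logic.I; rewrite in_itv/= andbT.
apply: measurableI.
  apply: fin_bigcap_measurable; first exact: finite_finset.
  move=> a _; rewrite -[X in measurable X]setTI; exact: measurable_eval.
rewrite -[X in measurable X]setTI.
by apply: measurable_sum => // a; exact: measurable_eval.
Qed.

Lemma measurable_iid_pmf (R : realType) (A : finType) k (x : k.-tuple A) :
  measurable_fun setT (fun Q : pmf_space R A => iid_pmf Q x).
Proof.
by apply: measurable_prod => i _; exact: measurable_eval.
Qed.

(** Each factor is an average of indicators over positions j in [y]. Expanding the product of k such
    sums amounts to choosing a position [f i] for every i. *)
Lemma iid_pmf_type_of (R : realType) (A : finType) n (y : n.-tuple A) k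
    (x : k.-tuple A) :
  iid_pmf (type_of R y) x =
  n%:R ^- k *
  \sum_(f : {ffun 'I_k -> 'I_n}) ([forall i, tnth y (f i) == tnth x i])%:R.
Proof.
transitivity
    (\prod_(i < k) (\sum_(j < n) ((tnth y j == tnth x i)%:R : R)) * n%:R ^- k).
  rewrite /iid_pmf /type_of -exprVn.
  rewrite -[X in _ * _ ^+ X](card_ord k) -prodr_const -big_split/=.
  apply: eq_bigr => i _; congr (_ / _).
  rewrite -sum1_card natr_sum big_mkcond.
  by apply: eq_bigr => j _; rewrite inE; case: eqP.
rewrite mulrC bigA_distr_bigA/=; congr (_ * _); apply: eq_bigr => f _.
case: forallP => [h|/forallP]; first by rewrite big1// => i _; rewrite h.
by rewrite negb_forall => /existsP[i /negPf h]; rewrite (bigD1 i)//= h mul0r.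
Qed.

(** A change of variables turns the integral over the simplex into an expectation over [Omega]. The
    expansion of [iid_pmf] at a type then makes the integrand a finite sum of indicators, integrated
    term by term. *)
Lemma mixture_type_law (R : realType) d (Omega : measurableType d)
    (P : probability Omega R) (A : finType) n (X : 'I_n -> finite_rv Omega A) k
    (x : k.-tuple A) : (0 < n)%N ->
  mixture (type_law P X) x =
  n%:R ^- k * \sum_(f : {ffun 'I_k -> 'I_n}) joint_pmf P (X \o f) x.
Proof.
move=> n_gt0; rewrite -[RHS]/(fine _%:E) /mixture /Rintegral; congr fine.
have -> : (\int[type_law P X]_(Q in @simplex R A) (iid_pmf Q x)%:E =
    \int[P]_w (n%:R ^- k * \sum_(f : {ffun 'I_k -> 'I_n})
       \1_(joint (X \o f) @^-1` [set x])%classic w)%:E)%E.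
  rewrite /type_law /distribution ge0_integral_pushforward//=; last first.
  - move=> Q /set_mem[Q0 _]; rewrite lee_fin; exact: prodr_ge0.
  - apply/measurable_EFinP; apply: measurable_funTS; exact: measurable_iid_pmf.
  - exact: measurable_simplex.
  (* Positivity of n matters here: the type of an empty tuple is the zero function, which is outside
     the simplex. *)
  have -> : (random_type R X @^-1` @simplex R A = setT)%classic.
    by apply/seteqP; split=> // w _; exact: type_of_simplex.
  apply: eq_integral => w _; rewrite /= /random_type iid_pmf_type_of.
  congr (_ * _)%:E; apply: eq_bigr => f _; rewrite indicE; congr ((nat_of_bool _)%:R).
  apply/forallP/idP => [h|/set_mem/= <- i]; last by rewrite !tnth_mktuple.
  apply/mem_set; apply: eq_from_tnth => i; move: (h i).
  by rewrite !tnth_mktuple => /eqP.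
have mI (f : {ffun 'I_k -> 'I_n}) :
    measurable (joint (X \o f) @^-1` [set x])%classic.
  exact: joint_measurable.
under eq_integral do rewrite EFinM -sumEFin.
rewrite ge0_integralZl//=.
- rewrite ge0_integral_sum//; last by move=> f; exact/measurable_EFinP.
  rewrite EFinM -sumEFin; congr (_ * _)%E; apply: eq_bigr => f _.
  by rewrite integral_indic// setIT joint_pmfE.
- by apply: emeasurable_sum => f; exact/measurable_EFinP.
- by move=> w _; apply: sume_ge0.
Qed.

Lemma joint_pmf_le_mixture (R : realType) d (Omega : measurableType d)
    (P : probability Omega R) (A : finType) n (X : 'I_n -> finite_rv Omega A) k
    (le_k_n : (k <= n)%N) (x : k.-tuple A) : (0 < n)%N -> exchangeable P X ->
  (n ^_ k)%:R * joint_pmf P (first_rvs le_k_n X) x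
  <= n%:R ^+ k * mixture (type_law P X) x.
Proof.
move=> n_gt0 exX; rewrite mixture_type_law// mulVKf; last first.
  by rewrite expf_neq0// pnatr_eq0 -lt0n.
rewrite (bigID (fun f : {ffun 'I_k -> 'I_n} => injectiveb f))/=.
apply: ler_wpDr; first by apply: sumr_ge0 => *; exact: joint_pmf_ge0.
under eq_bigr => f /injectiveP f_inj.
  rewrite /joint_pmf (@exchangeable_inj _ _ _ _ _ _ _ _ le_k_n)//.
  over.
(* All remaining terms are equal, and [n ^_ k] is the number of injective maps. *)
have := card_inj_ffuns 'I_k 'I_n; rewrite !card_ord cardsE => <-.
by rewrite sumr_const mulr_natl.
Qed.

(** * Entropy and numerical bounds *)

Lemma relative_entropy_le_ln (R : realType) (B : finType) (P Q : B -> R) (c : R) :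
  0 < c -> (forall x, 0 <= P x) -> (forall x, 0 <= Q x) -> \sum_x P x = 1 ->
  (forall x, P x <= c * Q x) -> (relative_entropy P Q <= (ln c)%:E)%E.
Proof.
(* The domination by [c * Q] forces [P] to vanish wherever [Q] does, so the entropy is the finite
   sum. *)
move=> c_gt0 P0 Q0 P1 PQ; rewrite /relative_entropy ifT; last first.
  apply/forallP => x; apply/implyP => /eqP Qx.
  by rewrite eq_le P0 andbT -(mulr0 c) -Qx PQ.
(* Since [P] has mass 1, [ln c] is its own average under [P], and the comparison is termwise. *)
rewrite lee_fin -[leRHS]mul1r -P1 mulr_suml; apply: ler_sum => x _.
have [->|Px] := eqVneq (P x) 0; first by rewrite !mul0r.
have Px_gt0 : 0 < P x by rewrite lt_def Px P0.
have Qx_gt0 : 0 < Q x.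
  rewrite -(pmulr_rgt0 _ c_gt0); exact: lt_le_trans (PQ x).
by rewrite ler_pM2l// ler_ln ?posrE ?divr_gt0// ler_pdivrMr.
Qed.


(** Every factor of [n ^_ k] is at least n - k, so the ratio is at most (1 + k / (n - k)) ^ k. Then
    ln (1 + u) <= u, and 2 k <= n gives n - k >= n / 2. *)
Lemma ln_ffact_ratio_le (R : realType) (n k : nat) :
  (0 < n)%N -> (2 * k <= n)%N ->
  ln (n%:R ^+ k / (n ^_ k)%:R) <= 2 * k%:R ^+ 2 / n%:R :> R.
Proof.
move=> n_gt0 kn.
have n0 : 0 < n%:R :> R by rewrite ltr0n.
have kn' : 2 * k%:R <= n%:R :> R by rewrite -natrM ler_nat.
have k0 : 0 <= k%:R :> R by [].
have nk : 0 < n%:R - k%:R :> R by lra.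
have ffact_ge : (n%:R - k%:R) ^+ k <= (n ^_ k)%:R :> R.
  rewrite ffact_prod natr_prod -[X in _ ^+ X]card_ord -prodr_const.
  apply: ler_prod => i _; rewrite (ltW nk)/= natrB; last by have := ltn_ord i; lia.
  by rewrite lerB// ler_nat ltnW.
have -> : 2 * k%:R ^+ 2 / n%:R = (2 * k%:R / n%:R) *+ k :> R.
  by rewrite -mulr_natr; ring.
have q_gt0 : 0 < n%:R / (n%:R - k%:R) :> R by rewrite divr_gt0.
have ffact_n_gt0 : 0 < (n ^_ k)%:R :> R by exact: lt_le_trans (exprn_gt0 k nk) _.
apply: (@le_trans _ _ (ln ((n%:R / (n%:R - k%:R)) ^+ k))).
  rewrite ler_ln ?posrE ?exprn_gt0 ?divr_gt0 ?exprn_gt0//.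
  by rewrite expr_div_n ler_pM2l ?exprn_gt0// lef_pV2 ?posrE ?exprn_gt0.
rewrite lnXn// lerMn2r; apply/orP; right.
have -> : n%:R / (n%:R - k%:R) = 1 + k%:R / (n%:R - k%:R) :> R by field; lra.
apply: (@le_trans _ _ (k%:R / (n%:R - k%:R))).
  apply: le_ln1Dx; apply: (@lt_le_trans _ _ 0); first by rewrite ltrN10.
  by rewrite divr_ge0// ltW.
rewrite ler_pdivrMr// mulrAC ler_pdivlMr//; nra.
Qed.

Lemma delta_ge (R : realType) (m n k : nat) :
  (0 < m)%N -> (0 < k)%N -> (100 * k ^ 2 <= n)%N ->
  k%:R ^+ 2 / n%:R <= delta R m n k.
Proof.
move=> m_gt0 k_gt0 kn; rewrite /delta /alpha.
have n0 : 0 < n%:R :> R by rewrite ltr0n; lia.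
have k0 : 0 < k%:R :> R by rewrite ltr0n.
set r := Num.sqrt n%:R; have r_gt0 : 0 < r by rewrite sqrtr_gt0.
have r2 : r ^+ 2 = n%:R by rewrite sqr_sqrtr// ltW.
have kr : 10 * k%:R <= r.
  rewrite -(@ler_pXn2r _ 2)// ?nnegrE ?mulr_ge0// ?(ltW r_gt0)//.
  by rewrite r2 exprMn -natrX -natrX -natrM ler_nat.
rewrite -r2 -expr_div_n; set t := k%:R / r.
have t0 : 0 < t by rewrite divr_gt0.
have t1 : t <= 1 / 10 by rewrite ler_pdivrMr//; lra.
have r1 : r^-1 <= t by rewrite ler_peMl ?invr_ge0 ?(ltW r_gt0)// ler1n.
set a2 := (X in Num.sqrt X).
have a2E : a2 = 2 * t * (r^-1 + 2 * t + 1) by rewrite /a2 /t; field; lra.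
have rV0 : 0 < r^-1 by rewrite invr_gt0.
have a2_gt0 : 0 < a2 by rewrite a2E; nra.
(* Both [r^-1 <= t] and [t <= 1 / 10] enter: a2 <= 2 t (3 t + 1) <= 0.26 < 0.36. *)
have a2_le : a2 <= (6 / 10) ^+ 2 by rewrite a2E; nra.
have a2_ge : 2 * t <= a2 by rewrite a2E; nra.
set a := Num.sqrt a2; have a_gt0 : 0 < a by rewrite sqrtr_gt0.
have a2a : a ^+ 2 = a2 by rewrite sqr_sqrtr// ltW.
have a_le : a <= 6 / 10.
  by rewrite -(@ler_pXn2r _ 2)// ?a2a// nnegrE ?(ltW a_gt0)//; lra.
(* As m ^ k >= 1, the logarithm is at least - ln a, and ln (1 + u) <= u at u = a - 1 gives - ln a >=
   1 - a. *)
have ln_ge : 1 - a <= ln ((m ^ k)%:R / a).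
  have M1 : 1 <= (m ^ k)%:R :> R by rewrite ler1n expn_gt0 m_gt0.
  rewrite lnM ?posrE ?invr_gt0//; last by lra.
  rewrite lnV ?posrE//; have := ln_ge0 M1.
  by have := @le_ln1Dx _ (a - 1); rewrite subrKC; lra.
apply: (@le_trans _ _ (a * (1 - a))); last by rewrite ler_pM2l.
(* Here a >= a ^ 2 >= 2 t and 1 - a >= 4 / 10, so a (1 - a) >= 0.8 t >= t ^ 2. *)
nra.
Qed.

Theorem theorem1 (R : realType) (d : measure_display)
    (Omega : measurableType d) (P : probability Omega R)
    (A : finType) (m : nat) (hm : m = #|A|)
    (n : nat) (hn : (1 <= n)%N)
    (X : 'I_n -> finite_rv Omega A) (hX : exchangeable P X)
    (k : nat) (hk1 : (1 <= k)%N) (hkn : (k <= n)%N)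
    (hk : k%:R <= (n%:R / 100) `^ (1 / 3) :> R) :
  (relative_entropy (joint_pmf P (first_rvs hkn X)) (mixture (type_law P X) (k := k))
   <= (2 * delta R m n k
       + k%:R * expR (- (n%:R / k%:R * delta R m n k))
         * (n%:R / k%:R + 1) ^+ (2 * m ^ k) * ln n%:R)%:E)%E.
Proof.
(* A measurable type is pointed, so evaluating a variable at [point] exhibits a letter of [A]. *)
have m_gt0 : (0 < m)%N by rewrite hm; apply/card_gt0P; exists (X (Ordinal hn) point).
have n0 : 0 < n%:R :> R by rewrite ltr0n.
have k_sq : (100 * k ^ 2 <= n)%N.
  (* Cubing the hypothesis on k bounds k ^ 3, which dominates k ^ 2 because k >= 1. *)
  suff : (100 * k ^ 3 <= n)%N by apply: leq_trans; rewrite leq_mul2l leq_pexp2l.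
  have : k%:R ^+ 3 <= (n%:R / 100) `^ (1 / 3) ^+ 3 :> R.
    by rewrite lerXn2r// nnegrE ?powR_ge0.
  rewrite -[leRHS]powR_mulrn ?powR_ge0// -powRrM divfK ?pnatr_eq0// powRr1; last first.
    by rewrite divr_ge0 // ltW.
  by rewrite ler_pdivlMr// -natrX -natrM ler_nat mulnC.
have ffact_n_gt0 : 0 < (n ^_ k)%:R :> R by rewrite ltr0n ffact_gt0.
apply: le_trans (_ : (ln (n%:R ^+ k / (n ^_ k)%:R))%:E <= _)%E; last first.
  rewrite lee_fin; apply: ler_wpDr.
    by rewrite !mulr_ge0 ?expR_ge0 ?ln_ge0 ?ler1n// exprn_ge0// addr_ge0.
  apply: (le_trans (@ln_ffact_ratio_le _ _ _ hn _)); first by nia.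
  by rewrite -mulrA ler_pM2l// delta_ge.
apply: relative_entropy_le_ln.
- by rewrite divr_gt0// exprn_gt0.
- exact: joint_pmf_ge0.
- move=> x; rewrite mixture_type_law// mulr_ge0 ?invr_ge0 ?exprn_ge0 ?sumr_ge0//.
  by move=> f _; exact: joint_pmf_ge0.
- exact: sum_joint_pmf.
- by move=> x; rewrite mulrAC ler_pdivlMr// mulrC joint_pmf_le_mixture.
Qed.
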